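(* Let $F$ be a locally compact complete non-Archimedean field with nontrivial valuation. Let $A$ be a commutative unital Banach $F$-algebra with $\|a^{2}\|_{A}=\|a\|_{A}^{2}$ for all $a\in A$ and finite basic dimension. Then, for some finite extension $L$ of $F$ extending $F$ as a valued field: (i) the character space $\mathcal{M}(A)$ of $A$ relative to $L$ is defined, each $x\in\mathcal{M}(A)$ giving a non-zero $L$-valued multiplicative $F$-linear functional $\hat{x}:A\to L$; (ii) the space $\mathcal{M}(A)$, with the Gelfand topology, is a totally disconnected compact Hausdorff space; (iii) $A$ is isometrically $F$-isomorphic to an ${}^{L}/_{F}$ function algebra on $(\mathcal{M}(A),g,g)$ for some $g\in\mathrm{Gal}(L/F)$.
   Context: A valuation on a field $F$ is a multiplicative norm $|\cdot|_{F}:F\to\mathbb{R}$; $F$ with a valuation is a valued field, complete if complete in the induced metric, non-Archimedean if $|a-b|_F\le\max(|a|_F,|b|_F)$ for all $a,b$. The valuation is trivial if it takes only the values $0,1$. $L$ extends $F$ as a valued field if $F$ is a subfield of $L$ and $|\cdot|_L$ restricts to $|\cdot|_F$. $\mathrm{Gal}(L/F)$ is the group of automorphisms of $L$ fixing $F$ pointwise; $L^{g}:=\{x\in L:g(x)=x\}$. A unital Banach $F$-algebra is an associative $F$-algebra $A$ with identity $1\neq 0$, complete with respect to a norm satisfying $\|ab\|_A\le\|a\|_A\|b\|_A$, $\|\alpha a\|_A=|\alpha|_F\|a\|_A$ for $\alpha\in F$, and $\|1\|_A=1$. ''Isometrically $F$-isomorphic'' means isomorphic as $F$-algebras by a norm-preserving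 map; an $F$-isomorphism of fields is an isomorphism fixing $F$ pointwise. A bounded multiplicative seminorm on $A$ is a map $|\cdot|:A\to[0,\infty)$, not constantly zero, with $|a|\le\|a\|_A$, $|ab|=|a||b|$, $|a+b|\le|a|+|b|$, $|0|=0$. Let $\mathcal{M}_0(A)$ be the set of all proper closed prime ideals of $A$ that are kernels of bounded multiplicative seminorms on $A$. $A$ has finite basic dimension if there exists a finite extension $L$ of $F$ extending $F$ as a valued field ($L=F$ allowed) such that (1) for each $J\in\mathcal{M}_0(A)$ the field of fractions $\mathrm{Frac}(A/J)$ is $F$-isomorphic to a subfield of $L$, and (2) there is $g\in\mathrm{Gal}(L/F)$ with $L^g=F$. (In this case each quotient $A/J$, $J\in\mathcal{M}_0(A)$, is itself a field.) Character space: for such an $L$ witnessing finite basic dimension, $\mathcal{M}(A)$ is the set of all pairs $x=(x_0,\varphi)$ with $x_0\in\mathcal{M}_0(A)$ and $\varphi$ an $F$-isomorphism from $A/x_0$ onto a subfield of $L$ extending $F$. To $x=(x_0,\varphi)$ is associated $\hat{x}:A\to L$, $\hat{x}(a):=\varphi(a+x_0)$. For $a\in A$ put $\hat{a}:\mathcal{M}(A)\to L$, $\hat{a}(x):=\hat{x}(a)$. The Gelfand topology on $\mathcal{M}(A)$ is the weakest topology making all $\hat{a}$, $a\in A$, continuous. An element $g\in\mathrm{Gal}(L/F)$ acts on $\mathcal{M}(A)$ by $g((x_0,\varphi)):=(x_0,g\circ\varphi)$; in the triple $(\mathcal{M}(A),g,g)$ the first $g$ is this map on $\mathcal{M}(A)$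 and the second is the automorphism of $L$. Function algebras: let $X$ be a totally disconnected compact Hausdorff space, $g\in\mathrm{Gal}(L/F)$, and $\tau:X\to X$ continuous of finite order with $\mathrm{ord}(\tau)\mid\mathrm{ord}(g)$. Let $C_L(X)$ be the continuous $L$-valued functions on $X$ with the sup norm, and $C(X,\tau,g):=\{f\in C_L(X): f(\tau(x))=g(f(x))\ \forall x\in X\}$. An ${}^{L}/_{L^{g}}$ function algebra on $(X,\tau,g)$ is a subset of $C(X,\tau,g)$ that is an $L^{g}$-algebra under pointwise operations, is complete in the sup norm, contains the constants $L^{g}$, and separates the points of $X$ (for $x_1\ne x_2$ some $f$ in it has $f(x_1)\ne f(x_2)$). Saying it is an ${}^{L}/_{F}$ function algebra on $(X,\tau,g)$ means additionally $L^{g}=F$. *)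

(* Defs.v *)
From HB Require Import structures.
From mathcomp Require Import all_boot all_order all_algebra all_field.
From mathcomp Require Import all_classical all_reals all_analysis.
Set Implicit Arguments.
Unset Strict Implicit.
Unset Printing Implicit Defensive.
Import Order.TTheory GRing.Theory Num.Theory.
Import numFieldNormedType.Exports.
Local Open Scope classical_set_scope.
Local Open Scope ring_scope.

(* The norms needed here cannot be [normedZmodType] norms: those satisfy
   `|x *+ n| = `|x| *+ n, which fails over a non-Archimedean field. *)
Record group_norm (R : realType) (V : zmodType) := GroupNorm {
  gnorm :> V -> R;
  gnorm_ge0 : forall x, 0 <= gnorm x;
  gnorm_eq0 : forall x, gnorm x = 0 <-> x = 0;
  gnormN : forall x, gnorm (- x) = gnorm x;
  gnormD : forall x y, gnorm (x + y) <= gnorm x + gnorm y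
}.

(* [normed N] is V with the metric N (x - y) and its topology. *)
Definition normed (R : realType) (V : zmodType) (N : group_norm R V) : Type := V.

Section NormedMetric.
Variables (R : realType) (V : zmodType) (N : group_norm R V).

HB.instance Definition _ := GRing.Zmodule.on (normed N).
HB.instance Definition _ := isPointed.Build (normed N) (0 : V).

Let dist (x y : normed N) : R := N ((x : V) - y).

Let distxx x : dist x x = 0.
Proof. by rewrite /dist subrr; apply/gnorm_eq0. Qed.

Let dist_positivity x y : dist x y = 0 -> x = y.
Proof. by move/gnorm_eq0/eqP; rewrite subr_eq0 => /eqP. Qed.

Let dist_sym x y : dist x y = dist y x.
Proof. by rewrite /dist -gnormN opprB. Qed.

Let dist_triangle y x z : dist x z <= dist x y + dist y z.
Proof. by rewrite /dist -[(x : V) - z](subrKA y) gnormD. Qed.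

HB.instance Definition _ := isMetric.Build R (normed N)
  distxx dist_positivity dist_sym dist_triangle.

End NormedMetric.

(* The content of [Uniform_isComplete], as a proposition. *)
Definition complete_space (T : puniformType) : Prop :=
  forall G : set_system T, ProperFilter G -> cauchy G -> cvg G.

Definition is_valuation (R : realType) (F : fieldType) (v : group_norm R F) :
  Prop := forall x y, v (x * y) = v x * v y.

Definition nonarchimedean (R : realType) (F : fieldType) (v : group_norm R F) :
  Prop := forall a b, v (a - b) <= Num.max (v a) (v b).

Definition trivial_valuation (R : realType) (F : fieldType)
  (v : group_norm R F) : Prop := forall a, v a = 0 \/ v a = 1.

Definition extends_valued (R : realType) (F : fieldType) (vF : group_norm R F)
    (L : fieldExtType F) (vL : group_norm R L) : Prop :=
  is_valuation vL /\ forall c : F, vL c%:A = vF c.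

(* The group Gal(L/F); the library's ['Gal(E / K)] needs a splitting field,
   while L is here an arbitrary finite extension. *)
Record galois_aut (F : fieldType) (L : fieldExtType F) := MkGaloisAut {
  gal_fun :> 'End(L);
  gal_kAut : kAut 1 {:L} gal_fun
}.

Record is_unital_banach (R : realType) (F : fieldType) (vF : group_norm R F)
    (A : algType F) (nA : group_norm R A) : Prop := {
  banach_complete : complete_space (normed nA);
  banach_mul : forall a b : A, nA (a * b) <= nA a * nA b;
  banach_scale : forall (c : F) (a : A), nA (c *: a) = vF c * nA a;
  banach_one : nA 1 = 1
}.

Section Residue.
Variables (A : comNzRingType) (I : prime_idealr A).

Definition residue : Type := {ideal_quot I}.

HB.instance Definition _ := GRing.ComNzRing.on residue.

Definition residue_class (a : A) : residue := (\pi_{ideal_quot I} a)%qT.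

(* [idomainType], hence {fraction _}, requires an inverse function. *)
Let unit : pred residue := fun x => `[< exists y, y * x = 1 >].

Let inv (x : residue) : residue :=
  if pselect (exists y, y * x = 1) is left h then projT1 (cid h) else x.

Let mulVx : {in unit, left_inverse 1 inv *%R}.
Proof.
move=> x /asboolP ux; rewrite /inv; case: pselect => // h.
by case: (cid h).
Qed.

Let unitP (x y : residue) : y * x = 1 -> unit x.
Proof. by move=> xy; apply/asboolP; exists y. Qed.

Let inv_out : {in [predC unit], inv =1 id}.
Proof.
move=> x /= /asboolP ux; rewrite /inv; case: pselect => // h.
Qed.

HB.instance Definition _ := GRing.ComNzRing_hasMulInverse.Build residue
  mulVx unitP inv_out.

HB.instance Definition _ := GRing.ComUnitRing_isIntegral.Build residue
  (@Quotient.rquot_IdomainAxiom A I).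

End Residue.

Section CharacterSpace.
Variables (R : realType) (F : fieldType) (A : comAlgType F).
Variable (nA : group_norm R A).

Record bounded_mult_seminorm (N : A -> R) : Prop := {
  bms_ge0 : forall a, 0 <= N a;
  bms_nonzero : exists a, N a <> 0;
  bms_bounded : forall a, N a <= nA a;
  bms_mul : forall a b, N (a * b) = N a * N b;
  bms_add : forall a b, N (a + b) <= N a + N b;
  bms_zero : N 0 = 0
}.

(* [idealr_closed] includes properness. *)
Record M0 := MkM0 {
  M0_set :> set A;
  M0_ideal : idealr_closed (in_set M0_set);
  M0_prime : prime_idealr_closed (in_set M0_set);
  M0_closed : closed (M0_set : set (normed nA));
  M0_kernel : exists2 N : A -> R, bounded_mult_seminorm N &
    M0_set = [set a | N a = 0]
}.

Definition M0_pred (J : M0) : A -> bool := in_set J.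

HB.instance Definition _ (J : M0) := isIdealr.Build A (M0_pred J) (@M0_ideal J).
HB.instance Definition _ (J : M0) :=
  isPrimeIdealrClosed.Build A (M0_pred J) (@M0_prime J).

Definition quot (J : M0) : idomainType := residue (M0_pred J).

Definition quot_class (J : M0) (a : A) : quot J :=
  residue_class (M0_pred J) a.

Variable L : fieldExtType F.

(* [phi] is an isomorphism fixing F from K onto a subfield of L (which then
   contains F), where [iota] is the embedding of F in K. *)
Record is_iso_onto_subfield (K : nzRingType) (iota : F -> K) (phi : K -> L) :
    Prop := {
  iso_zmod : zmod_morphism phi;
  iso_monoid : monoid_morphism phi;
  iso_inj : injective phi;
  iso_fix : forall c : F, phi (iota c) = c%:A;
  iso_range : divring_closed (in_set (range phi))
}.

Definition basic_dimension_witness : Prop :=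
  (forall J : M0, exists phi : {fraction quot J} -> L,
     is_iso_onto_subfield (fun c : F => FracField.tofrac (quot_class J c%:A)) phi) /\
  (exists g : galois_aut L, fixedSpace g = 1%VS).

(* The pairs (x_0, phi); the topology is put on [character_space] below, as it
   depends on the valuation of L. *)
Record character := MkCharacter {
  char_ker : M0;
  char_iso : quot char_ker -> L;
  char_isoP :
    is_iso_onto_subfield (fun c : F => quot_class char_ker c%:A) char_iso
}.

HB.instance Definition _ := gen_eqMixin character.
HB.instance Definition _ := gen_choiceMixin character.

Definition char_eval (x : character) (a : A) : L :=
  char_iso (quot_class (char_ker x) a).

Definition gelfand_transform (a : A) (x : character) : L := char_eval x a.

Definition character_space (vL : group_norm R L) : topologicalType :=
  sup_topology (fun a : A => Topological.on
    (initial_topology (gelfand_transform a : character -> normed vL))).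

Lemma gal_comp_iso (g : galois_aut L) (K : nzRingType) (iota : F -> K) (phi : K -> L) :
  is_iso_onto_subfield iota phi -> is_iso_onto_subfield iota (g \o phi).
Proof.
case=> phiB phiM phi_inj phi_fix [r1 rB rV].
have /andP[gH _] := gal_kAut g.
have /kHomP_tmp[g_fix gM] := gH.
have g1 : g 1 = 1 by rewrite g_fix ?mem1v.
have gV z : g z^-1 = (g z)^-1 by rewrite (kHom_inv gH) ?memvf.
have gI : injective g.
  move=> x y /eqP; rewrite -subr_eq0 -raddfB => gxy0; apply/eqP.
  rewrite -subr_eq0; apply: contraT => nz.
  have := gM (x - y) (x - y)^-1; rewrite !memvf mulfV // g1 (eqP gxy0) mul0r.
  by move=> /(_ isT isT)/eqP; rewrite oner_eq0.
have im z : (z \in range (g \o phi)) = (z \in [set g y | y in range phi]).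
  by rewrite image_comp.
have imP z : reflect (exists2 y, y \in range phi & g y = z)
    (z \in range (g \o phi)).
  apply: (iffP idP); rewrite im inE => -[y].
    by move=> yphi <-; exists y; rewrite ?inE.
  by rewrite inE => yphi <-; exists y.
split.
- by move=> x y; rewrite /= phiB raddfB.
- by split=> [|x y]; rewrite /= phiM ?g1 // gM ?memvf.
- by move=> x y /gI/phi_inj.
- by move=> c; rewrite /= phi_fix linearZ /= g1.
- split.
  + by apply/imP; exists 1.
  + move=> _ _ /imP[x xr <-] /imP[y yr <-]; apply/imP; exists (x - y).
      exact: rB.
    by rewrite raddfB.
  + move=> _ _ /imP[x xr <-] /imP[y yr <-]; apply/imP; exists (x / y).
      exact: rV.
    by rewrite gM ?memvf // gV.
Qed.

Definition gal_act (vL : group_norm R L) (g : galois_aut L)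
    (x : character_space vL) : character_space vL :=
  MkCharacter (gal_comp_iso g (char_isoP x)).

End CharacterSpace.

Arguments gal_act {R F A} nA {L} vL g x.

Section FunctionAlgebra.
Variables (R : realType) (F : fieldType) (L : fieldExtType F).
Variables (vL : group_norm R L) (X : topologicalType).

Definition sup_norm (f : X -> L) : R := sup (range (vL \o f)).

Definition has_order (T : Type) (f : T -> T) (n : nat) : Prop :=
  [/\ (0 < n)%N, iter n f =1 id &
      forall m, (0 < m < n)%N -> ~ (iter m f =1 id)].

Variables (tau : X -> X) (g : galois_aut L).

Record admissible_triple : Prop := {
  triple_compact : compact [set: X];
  triple_hausdorff : hausdorff_space X;
  triple_totally_disconnected : totally_disconnected [set: X];
  triple_continuous : continuous tau;
  triple_order : exists m n,
    [/\ has_order tau m, has_order g n & (m %| n)%N]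
}.

Definition twisted_continuous : set (X -> L) :=
  [set f | continuous (f : X -> normed vL) /\ forall x, f (tau x) = g (f x)].

Definition sup_complete (S : set (X -> L)) : Prop :=
  forall u : nat -> X -> L, (forall n, S (u n)) ->
    (forall e : R, 0 < e ->
       exists N, forall m n, (N <= m)%N -> (N <= n)%N ->
         sup_norm (fun x => u m x - u n x) < e) ->
    exists2 f, S f & sup_norm (fun x => u n x - f x) @[n --> \oo] --> (0 : R).

(* L/L^g function algebras on (X, tau, g), where L^g is [fixedSpace g]. *)
Record function_algebra (S : set (X -> L)) : Prop := {
  fa_triple : admissible_triple;
  fa_sub : S `<=` twisted_continuous;
  fa_add : forall f h, S f -> S h -> S (fun x => f x + h x);
  fa_mul : forall f h, S f -> S h -> S (fun x => f x * h x);
  fa_scale : forall c f, c \in fixedSpace g -> S f -> S (fun x => c * f x);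
  fa_const : forall c, c \in fixedSpace g -> S (fun=> c);
  fa_complete : sup_complete S;
  fa_separates : forall x1 x2 : X, x1 <> x2 -> exists2 f, S f & f x1 <> f x2
}.

Definition function_algebra_over (S : set (X -> L)) : Prop :=
  function_algebra S /\ fixedSpace g = 1%VS.

Definition isometric_iso_onto (A : algType F) (nA : group_norm R A)
    (S : set (X -> L)) (T : A -> X -> L) : Prop :=
  [/\ range T = S,
      forall a b x, T (a + b) x = T a x + T b x,
      forall a b x, T (a * b) x = T a x * T b x,
      forall (c : F) a x, T (c *: a) x = c *: T a x &
      forall x, T 1 x = 1] /\
  injective T /\ forall a, sup_norm (T a) = nA a.

End FunctionAlgebra.

Definition finite_basic_dimension (R : realType) (F : fieldType)
    (vF : group_norm R F) (A : comAlgType F) (nA : group_norm R A) : Prop :=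
  exists (L : fieldExtType F) (vL : group_norm R L),
    extends_valued vF vL /\ basic_dimension_witness nA L.

(* Main.v *)
From HB Require Import structures.
Require Import Defs.
From mathcomp Require Import all_boot all_order all_algebra all_field.
From mathcomp Require Import all_classical all_reals all_analysis.
From mathcomp Require Import ring lra.
Import Order.TTheory GRing.Theory Num.Theory.
Import numFieldNormedType.Exports.
Local Open Scope classical_set_scope.
Local Open Scope ring_scope.

(** Take L, with its valuation vL, to be the extension witnessing finite basic
    dimension, and send a to the function x |-> char_eval x a on the characters.
    The image of this map is the function algebra, once the following three
    facts are known.

    Isometry. For a != 0 some character attains vL (char_eval x a) = nA a. Since
    nA (b ^+ 2) = nA b ^+ 2, the limit of nA (a ^+ n * b) / nA a ^+ n is again a
    seminorm of this kind, for which multiplication by a scales by at least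
    nA a. Zorn's lemma gives a minimal seminorm p among those with this scaling
    property. The same limit construction, applied to p and any b with
    p b > 0, yields a candidate below p, hence p itself, which forces
    p (b * x) = p b * p x: thus p is multiplicative and p a = nA a
    ([exists_norming_multiplicative]). Its kernel J is a point of M0, finite
    basic dimension embeds A / J in L, and the absolute value of the resulting
    character is p, as explained next.

    Uniqueness of the absolute value. If N is a bounded multiplicative seminorm
    with the same kernel as a character x, then vL (char_eval x a) = N a
    ([char_eval_norm]). Both sides are norms on the finite-dimensional space
    A / J over the locally compact field F, so they are equivalent
    ([vsn_dominated]); applied to the powers of a, the equivalence gives <=, and
    applied to an inverse of a modulo J it gives equality. In particular every
    character is bounded by nA. The same argument shows that automorphisms of L
    are isometric ([galois_aut_isometry]), so that they act continuously on
    characters.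

    Topology. A ball of L is compact because its coordinates over F are bounded
    and balls of F are compact. Along an ultrafilter of characters the values
    at each a therefore converge, and the limits form a character: the character
    space is compact. Distinct characters differ in some coordinate of some
    value, and balls of F are clopen, so points are separated by clopen sets
    and the space is Hausdorff and totally disconnected.

    It remains to see that an automorphism g of L has finite order, which holds
    because it permutes the roots of each minimal polynomial
    ([galois_aut_finite_order]); the order of its action on characters then
    divides that of g. *)

(** * Norm topologies and valuations *)

Lemma monoid_morphism_exp {A B : pzSemiRingType} (f : A -> B) :
  monoid_morphism f -> forall a n, f (a ^+ n) = f a ^+ n.
Proof.
by move=> [f1 fM] a; elim=> [|n IH]; rewrite ?expr0 // !exprS fM IH.
Qed.

Lemma zmod_morphism_zero {U V : zmodType} (f : U -> V) : zmod_morphism f -> f 0 = 0.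
Proof. by move=> fB; rewrite -(subrr 0) fB subrr. Qed.

Lemma zmod_morphism_add {U V : zmodType} (f : U -> V) :
  zmod_morphism f -> {morph f : x y / x + y}.
Proof.
move=> fB x y; rewrite -{1}[y]opprK -{1}[- y]sub0r !fB zmod_morphism_zero //.
by rewrite sub0r opprK.
Qed.

Section NormedBasics.
Context {R : realType} {V : zmodType} (N : group_norm R V).

Lemma gnorm0 : N 0 = 0.
Proof. exact/gnorm_eq0. Qed.

Lemma gnorm_sym x y : N (x - y) = N (y - x).
Proof. by rewrite -gnormN opprB. Qed.

Lemma gnorm_lerB x y : N x - N y <= N (x - y).
Proof. by rewrite lerBlDr (le_trans _ (gnormD _ _ _)) ?subrK. Qed.

Lemma normed_ballE (x : normed N) e : ball x e = [set y | N ((x : V) - y) < e].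
Proof. by rewrite ballEmdist. Qed.

Lemma normed_cvgP {T : Type} {U : set_system T} {FU : Filter U}
    (f : T -> normed N) (y : normed N) :
  f @ U --> y <-> forall e : R, 0 < e -> \forall t \near U, N ((f t : V) - y) < e.
Proof.
split=> [/cvg_ballP h e e0|h].
  have := h e e0; apply: filterS => t; rewrite normed_ballE /=.
  by rewrite gnorm_sym.
apply/cvg_ballP => e e0; have := h e e0; apply: filterS => t.
by rewrite normed_ballE /= gnorm_sym.
Qed.

Lemma normed_le_closed (f : normed N -> R) (r : R) :
  (forall x y, f x - f y <= N ((x : V) - y)) -> closed [set x | f x <= r].
Proof.
move=> lip x clx /=; apply/ler_addgt0Pl => e e0.
have [y [/= fy]] := clx _ (nbhsx_ballx x _ e0).
rewrite normed_ballE /= => xy.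
have := lip x y; lra.
Qed.

End NormedBasics.

Lemma normed_lipschitz_continuous {R : realType} {V W : zmodType}
    (N : group_norm R V) (M : group_norm R W) (f : V -> W) (C : R) :
  (forall x y, M (f x - f y) <= C * N (x - y)) ->
  continuous (f : normed N -> normed M).
Proof.
move=> lip x; apply/(normed_cvgP M (U := nbhs (x : normed N))) => e e0.
have C1 : 0 < `|C| + 1 by rewrite ltr_wpDl.
have := nbhsx_ballx (x : normed N) _ (divr_gt0 e0 C1).
apply: filterS => y; rewrite normed_ballE /= gnorm_sym ltr_pdivlMr // => xy.
apply: le_lt_trans (lip _ _) (le_lt_trans _ xy).
rewrite mulrC ler_wpM2l ?gnorm_ge0 // (le_trans (ler_norm C)) //.
by rewrite lerDl.
Qed.

Section Valuation.
Context {R : realType} {F : fieldType} (v : group_norm R F).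
Hypothesis vM : is_valuation v.

Lemma val1 : v 1 = 1.
Proof.
have v1 : v 1 != 0 by apply/eqP => /gnorm_eq0/eqP; rewrite oner_eq0.
by apply: (mulfI v1); rewrite -vM !mulr1.
Qed.

Lemma valV x : v x^-1 = (v x)^-1.
Proof.
have [->|x0] := eqVneq x 0; first by rewrite invr0 gnorm0 invr0.
have vx : v x != 0 by apply: contra x0 => /eqP/gnorm_eq0 ->.
by apply: (mulfI vx); rewrite -vM !mulfV // val1.
Qed.

Lemma valX x n : v (x ^+ n) = v x ^+ n.
Proof. by apply: monoid_morphism_exp; split; [exact: val1|exact: vM]. Qed.

Lemma val_gt0 x : x != 0 -> 0 < v x.
Proof.
by move=> x0; rewrite lt_def gnorm_ge0 andbT; apply: contra x0 => /eqP/gnorm_eq0 ->.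
Qed.

(** Powers of a nonzero element of value other than 1, or of its inverse, tend
    to 0. *)
Lemma val_small : ~ trivial_valuation v ->
  forall e : R, 0 < e -> exists2 c : F, c != 0 & v c < e.
Proof.
move=> /existsNP[a /not_orP[a0 a1]] e e0.
have {}a0 : a != 0.
  by apply/eqP => az; apply: a0; rewrite az gnorm0.
have va0 := val_gt0 _ a0.
suff [b b0 b1] : exists2 b : F, b != 0 & v b < 1.
  have : (fun n => v b ^+ n) @ \oo --> (0 : R).
    by apply: cvg_expr; rewrite ger0_norm // gnorm_ge0.
  move/cvgr0Pnorm_lt => /(_ _ e0) [n _ /(_ n (leqnn n))] /=.
  rewrite ger0_norm ?exprn_ge0 ?gnorm_ge0 // => ve.
  by exists (b ^+ n); rewrite ?expf_neq0 // valX.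
have [va1|va1] := ltP (v a) 1; first by exists a.
exists a^-1; first by rewrite invr_neq0.
rewrite valV invf_lt1 // lt_def va1 andbT.
exact/eqP.
Qed.

Hypothesis v_lc : locally_compact [set: normed v].
Hypothesis v_nt : ~ trivial_valuation v.

(** A compact neighbourhood of the origin contains some ball, and
    multiplication by a scalar blows that ball up to any prescribed radius. *)
Lemma val_ball_compact (r : R) : compact [set x : normed v | v x <= r].
Proof.
have [K + [cK _]] := v_lc (0 : normed v) I.
rewrite /within /= => /nbhs_ballP[e /= e0 eK].
have r1 : 0 < `|r| + 1 by rewrite ltr_wpDl.
have [c c0 ce] := val_small v_nt _ (divr_gt0 e0 r1).
have vc0 := val_gt0 _ c0.
have cf : continuous ((fun x : F => c^-1 * x) : normed v -> normed v).
  apply: (normed_lipschitz_continuous v v _ (v c)^-1) => x y.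
  by rewrite -mulrBr vM valV.
have cI : compact ((fun x : normed v => (c^-1 * x : F) : normed v) @` K).
  by apply: continuous_compact => //; exact: continuous_subspaceT.
apply: (subclosed_compact _ cI).
  apply: (normed_le_closed v (v : normed v -> R)) => x y.
  exact: gnorm_lerB.
move=> x /= xr; exists (c * x : F); last by rewrite mulKf.
apply: eK => //; rewrite normed_ballE /= sub0r gnormN vM.
apply: le_lt_trans (_ : v c * (`|r| + 1) < e).
  by rewrite ler_wpM2l ?gnorm_ge0 // (le_trans xr) // ler_wpDr // ler_norm.
by rewrite -ltr_pdivlMr.
Qed.

End Valuation.

(** * Seminorms with a kernel of finite codimension *)

Lemma ultra_fmap {T X : Type} (U : set_system T) (f : T -> X) :
  UltraFilter U -> UltraFilter (f @ U).
Proof.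
move=> UU; split; first exact: fmap_proper_filter.
move=> G GG sUG; apply/seteqP; split=> // A GA.
have [//|UnA] := in_ultra_setVsetC (f @^-1` A) UU.
have GnA : G (~` A) by apply: sUG.
have G0 : G set0 by rewrite -(setICr A); exact: filterI.
by case: (@filter_not_empty _ G GG G0).
Qed.

Lemma ultra_compact_cvg {T : Type} {X : topologicalType} (U : set_system T)
    (K : set X) (f : T -> X) :
  UltraFilter U -> compact K -> (\forall t \near U, K (f t)) ->
  exists2 l, K l & f @ U --> l.
Proof.
move=> UU cK fK; have fU := ultra_fmap U f UU.
move: cK; rewrite compact_ultra => /(_ _ fU fK) /=.
by case=> l [Kl fl]; exists l.
Qed.

(** The kernel may be nonzero: the seminorms on A to which this applies have
    the ideals of M0 as kernels. *)
Record vector_seminorm {R : realType} {F : fieldType} (v : F -> R)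
    {V : lmodType F} (p : V -> R) : Prop := {
  vsn_ge0 : forall x, 0 <= p x;
  vsn_add : forall x y, p (x + y) <= p x + p y;
  vsn_scale : forall c x, p (c *: x) = v c * p x
}.

Section FiniteDimensionalSeminorms.
Context {R : realType} {F : fieldType} (v : group_norm R F).
Hypotheses (vM : is_valuation v) (v_lc : locally_compact [set: normed v])
  (v_nt : ~ trivial_valuation v).

Lemma vsn0 {V : lmodType F} (p : V -> R) : vector_seminorm v p -> p 0 = 0.
Proof. by move=> ps; rewrite -(scale0r (0 : V)) (vsn_scale _ _ ps) gnorm0 mul0r. Qed.

Lemma vsnN {V : lmodType F} (p : V -> R) x : vector_seminorm v p -> p (- x) = p x.
Proof.
by move=> ps; rewrite -scaleN1r (vsn_scale _ _ ps) gnormN val1 // mul1r.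
Qed.

Lemma vsn_sum {V : lmodType F} (p : V -> R) n (x : 'I_n -> V) :
  vector_seminorm v p -> p (\sum_i x i) <= \sum_i p (x i).
Proof.
move=> ps; elim: n x => [|n IH] x; first by rewrite !big_ord0 vsn0.
by rewrite !big_ord_recl (le_trans (vsn_add _ _ ps _ _)) // lerD2l.
Qed.

(** If no bound existed, scaling would give coefficient families with largest
    coefficient 1 whose combinations have arbitrarily small seminorm; by
    compactness of the unit ball they converge along an ultrafilter, and the
    limit family contradicts independence. *)
Lemma vsn_coord_bound {V : lmodType F} (p : V -> R) n (a : 'I_n -> V) :
  vector_seminorm v p ->
  (forall c : 'I_n -> F, p (\sum_i c i *: a i) = 0 -> forall i, c i = 0) ->
  exists2 C : R, 0 <= C &
    forall (c : 'I_n -> F) i, v (c i) <= C * p (\sum_j c j *: a j).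
Proof.
move=> ps indep; apply: contrapT => noC.
have /choice[d dP] : forall k : nat, exists d : 'I_n -> F,
    [/\ forall i, v (d i) <= 1, exists i, d i = 1 &
        k%:R * p (\sum_j d j *: a j) < 1].
  move=> k; have : exists (c : 'I_n -> F) i, k%:R * p (\sum_j c j *: a j) < v (c i).
    apply: contrapT => noc; apply: noC; exists k%:R => // c i.
    by rewrite leNgt; apply/negP => lt; apply: noc; exists c, i.
  move=> [c [i0 ci0]].
  (* Divide by the largest coefficient. *)
  pose i1 := [arg max_(i > i0) v (c i)]%O.
  have max_i1 i : v (c i) <= v (c i1).
    by rewrite /i1; case: arg_maxP => // j _; apply.
  have vc1 : 0 < v (c i1).
    apply: lt_le_trans (max_i1 i0); apply: le_lt_trans ci0.
    by rewrite mulr_ge0 ?(vsn_ge0 _ _ ps).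
  have c1 : c i1 != 0 by apply: contraTneq vc1 => ->; rewrite gnorm0 ltxx.
  exists (fun i => (c i1)^-1 * c i); split.
  - by move=> i; rewrite vM valV // mulrC ler_pdivrMr // mul1r.
  - by exists i1; rewrite mulVf.
  - under eq_bigr do rewrite -scalerA.
    rewrite -scaler_sumr (vsn_scale _ _ ps) valV // mulrCA ltr_pdivrMl // mulr1.
    exact: lt_le_trans ci0 (max_i1 i0).
have [U [UU ooU]] := ultraFilterLemma (F := \oo) _.
have /choice[l lP] : forall i, exists l : normed v,
    (fun k => d k i : normed v) @ U --> l.
  move=> i; have [|l _ dl] := ultra_compact_cvg U _ (fun k => d k i : normed v) UU
    (val_ball_compact v vM v_lc v_nt 1).
    by apply: filterE => k; have [/(_ i)] := dP k.
  by exists l.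
have lim e : 0 < e -> \forall k \near U, forall i, v (d k i - (l i : F)) < e.
  by move=> e0; apply: filter_forall => i; apply: (normed_cvgP v _ _).1 (lP i) _ e0.
have l0 : forall i, (l i : F) = 0.
  apply: indep; apply/eqP; rewrite eq_le (vsn_ge0 _ _ ps) andbT.
  apply/ler_addgt0Pl => e e0; rewrite addr0; pose M := 1 + \sum_i p (a i).
  have M0 : 0 < M by rewrite ltr_wpDr // sumr_ge0 // => i _; apply: vsn_ge0 ps _.
  have eM0 : 0 < e / M by rewrite divr_gt0.
  have [m me] : exists m : nat, M / e < m%:R.
    by exists (Num.trunc (M / e)).+1; rewrite truncnS_gt.
  have [k [dk mk]] := filter_ex (filterI (lim _ eM0) (ooU _ (nbhs_infty_ge m))).
  have -> : \sum_i (l i : F) *: a i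
      = \sum_i d k i *: a i + \sum_i - ((d k i - (l i : F)) *: a i).
    rewrite -big_split; apply: eq_bigr => i _ /=.
    by rewrite -scaleNr -scalerDl; congr (_ *: _); ring.
  apply: le_trans (vsn_add _ _ ps _ _) _.
  have -> : e = e / M + \sum_i (e / M) * p (a i).
    by rewrite -mulr_sumr -[X in X + _]mulr1 -mulrDr divfK // gt_eqF.
  apply: lerD.
    have [_ _] := dP k; set q := p _ => kq.
    have k0 : 0 < k%:R :> R.
      by apply: lt_le_trans (_ : m%:R <= _); [apply: lt_trans me; rewrite divr_gt0|rewrite ler_nat].
    have : q < k%:R^-1 by rewrite -[_^-1]mul1r ltr_pdivlMr // mulrC.
    move=> /ltW /le_trans; apply.
    rewrite -[e / M]invf_div lef_pV2 ?posrE ?divr_gt0 //.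
    by apply/ltW/(lt_le_trans me); rewrite ler_nat.
  apply: le_trans (vsn_sum _ _ _ ps) _; apply: ler_sum => i _.
  rewrite vsnN // (vsn_scale _ _ ps) ler_wpM2r ?(vsn_ge0 _ _ ps) //.
  exact/ltW/dk.
have [k dk] := filter_ex (lim 1 ltr01).
have [_ [i di] _] := dP k.
by have := dk i; rewrite di l0 subr0 val1 // ltxx.
Qed.

(** This plays the role of the equivalence of norms on a finite-dimensional
    space. V is not finite-dimensional in general, so the coefficient bound is
    applied to a maximal family of V with independent images under ell: it
    spans a complement of the kernel of ell. *)
Lemma vsn_dominated {V : lmodType F} {W : vectType F} (ell : {linear V -> W})
    (p q : V -> R) :
  vector_seminorm v p -> vector_seminorm v q ->
  (forall x, p x = 0 <-> ell x = 0) -> (forall x, ell x = 0 -> q x = 0) ->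
  exists2 C : R, 0 <= C & forall x, q x <= C * p x.
Proof.
move=> ps qs p0 q0.
pose P n := `[< exists s : seq V, size s = n /\ free (map ell s) >].
have exP : exists n, P n by exists 0%N; apply/asboolP; exists [::]; rewrite /= nil_free.
have leP n : P n -> (n <= \dim {:W})%N.
  move=> /asboolP[s [<- /eqP]]; rewrite size_map => <-.
  by rewrite dimvS // subvf.
case: (ex_maxnP exP leP) => n /asboolP[s [sz fs]] maxn.
pose a (i : 'I_n) := nth 0 s i.
have szl : size (map ell s) == n by rewrite size_map sz.
pose X := Tuple szl.
have aX (i : 'I_n) : ell (a i) = X`_i by rewrite -(nth_map 0 0) ?sz.
have spanX x : ell x \in <<X>>%VS.
  apply: contraT => nx; have : P n.+1.
    by apply/asboolP; exists (x :: s); rewrite /= sz free_cons fs nx.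
  by move/maxn; rewrite ltnn.
have [|C C0 CP] := vsn_coord_bound p n a ps.
  move=> c /p0; rewrite linear_sum => sum0.
  have /freeP freeX : free X by [].
  apply: freeX; rewrite -[RHS]sum0; apply: eq_bigr => i _.
  by rewrite linearZ /= aX.
have Q0 : 0 <= \sum_i q (a i) by apply: sumr_ge0 => i _; apply: vsn_ge0 qs _.
exists (C * \sum_i q (a i)); first by rewrite mulr_ge0.
move=> x; pose c i := coord X i (ell x); pose y := \sum_i c i *: a i.
have xy : ell (x - y) = 0.
  apply/eqP; rewrite linearB subr_eq0 linear_sum; apply/eqP.
  rewrite [LHS](coord_span (spanX x)); apply: eq_bigr => i _.
  by rewrite linearZ /= aX.
have pyx : p y <= p x.
  have := vsn_add _ _ ps (- (x - y)) x; rewrite (vsnN p (x - y) ps) ((p0 _).2 xy) add0r.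
  by rewrite opprB subrK.
have qxy : q x <= q y.
  by have := vsn_add _ _ qs (x - y) y; rewrite subrK (q0 _ xy) add0r.
apply: le_trans qxy (le_trans (vsn_sum _ _ _ qs) _).
rewrite mulrAC mulr_sumr; apply: ler_sum => i _.
rewrite (vsn_scale _ _ qs) ler_wpM2r ?(vsn_ge0 _ _ qs) //.
exact: le_trans (CP c i) (ler_wpM2l C0 pyx).
Qed.

End FiniteDimensionalSeminorms.

(** * Finite extensions of the base field *)

(** Taking n-th roots removes the constant from a comparison of
    multiplicative norms. *)
Lemma le_of_pow_le {R : realType} (a b C : R) : 0 <= b ->
  (forall n, a ^+ n <= C * b ^+ n) -> a <= b.
Proof.
move=> b0 h; rewrite leNgt; apply/negP => ba.
have a0 : 0 < a by apply: le_lt_trans ba.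
have C1 : 0 < `|C| + 1 by rewrite ltr_wpDl.
have ba0 : 0 <= b / a by rewrite divr_ge0 // ltW.
have : (fun n => (b / a) ^+ n) @ \oo --> (0 : R).
  by apply: cvg_expr; rewrite ger0_norm // ltr_pdivrMr // mul1r.
move/cvgr0Pnorm_lt => /(_ (`|C| + 1)^-1); rewrite invr_gt0 => /(_ C1).
move=> [n _ /(_ n (leqnn n))] /=.
rewrite ger0_norm ?exprn_ge0 //.
rewrite expr_div_n ltr_pdivrMr ?exprn_gt0 // ltr_pdivlMl //.
rewrite ltNge => /negP; apply; apply: le_trans (h n) _.
rewrite ler_wpM2r ?exprn_ge0 //.
by rewrite (le_trans (ler_norm C)) // lerDl.
Qed.

Section GaloisAutomorphisms.
Context {F : fieldType} {L : fieldExtType F} (g : galois_aut L).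

Lemma galois_aut_kHom : kHom 1 {:L} g.
Proof. by have /andP[] := Defs.gal_kAut g. Qed.

Lemma galois_aut_monoid : monoid_morphism g.
Proof. exact/kHom_monoid_morphism/galois_aut_kHom. Qed.

Lemma galois_aut_inj : injective g.
Proof.
move=> x y /eqP; rewrite -subr_eq0 -linearB => /eqP gxy; apply/eqP.
rewrite -subr_eq0; apply: contra_eqT (gxy) => xy.
have /kHom_inv/(_ (x - y) (memvf _)) gV := galois_aut_kHom.
have [g1 gM] := galois_aut_monoid.
apply/eqP => g0; have := gM (x - y) (x - y)^-1.
by rewrite mulfV // g1 g0 mul0r => /eqP; rewrite oner_eq0.
Qed.

(** The iterates of an element are roots of its minimal polynomial, so they
    repeat; a common period for a basis is a period of g. *)
Lemma galois_aut_finite_order : exists2 n, (0 < n)%N & iter n g =1 id.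
Proof.
have iter_inj n : injective (iter n g).
  by elim: n => [|n IH] // x y /galois_aut_inj/IH.
have period x : exists2 n, (0 < n)%N & iter n g x = x.
  pose p := minPoly 1 x.
  have rootp k : root p (iter k g x).
    elim: k => [|k IH]; first exact: root_minPoly.
    rewrite iterS.
    have gH : kHom 1%AS {:L}%AS g by exact: galois_aut_kHom.
    have p1 : p \is a polyOver 1%AS by exact: minPolyOver.
    exact: (kHom_root_id (subvf _) gH p1 (memvf _) IH).
  have : ~~ uniq (traject g x (size p).-1.+1).
    apply/negP => u; have : (size (traject g x (size p).-1.+1) < size p)%N.
      apply: max_poly_roots u; first exact/monic_neq0/monic_minPoly.
      by apply/allP => _ /trajectP[k _ ->].
    by rewrite size_traject prednK ?ltnn // size_poly_gt0 monic_neq0 // monic_minPoly.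
  rewrite looping_uniq negbK => /trajectP[i iltn it].
  exists ((size p).-1 - i)%N; first by rewrite subn_gt0.
  by apply: (iter_inj i); rewrite -iterD subnKC // ltnW.
have itermul n m x : iter n g x = x -> iter (n * m) g x = x.
  by move=> h; elim: m => [|m IH]; rewrite ?muln0 // mulnS iterD IH.
have iterlin n : linear (iter n g).
  by move=> c x y; elim: n => //= n ->; rewrite linearP.
have /choice[f fP] : forall x, exists n, (0 < n)%N /\ iter n g x = x.
  by move=> x; have [n] := period x; exists n.
pose b := vbasis {:L}.
pose n := (\prod_(i < \dim {:L}) f (b`_i)%R)%N; exists n.
  by apply: prodn_gt0 => i; have [] := fP b`_i.
move=> x /=.
pose h : {linear L -> L} := HB.pack (iter n g)
  (GRing.isLinear.Build F L L _ (iter n g) (iterlin n)).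
have xb : x \in <<b>>%VS by rewrite (span_basis (vbasisP _)) memvf.
rewrite (coord_span xb) -[LHS]/(h _) linear_sum; apply: eq_bigr => i _.
rewrite linearZ /=; congr (_ *: _).
rewrite /n (bigD1 i) //=; apply: itermul.
by have [] := fP b`_i.
Qed.

End GaloisAutomorphisms.

(** In a finite extension the inverse of x is a polynomial in x, so the image
    of an algebra map is a subfield. *)
Lemma alg_map_inv {F : fieldType} {A : comAlgType F} {L : fieldExtType F}
    (psi : A -> L) (a : A) :
  linear psi -> monoid_morphism psi -> exists b, psi b = (psi a)^-1.
Proof.
move=> lin mon.
pose ell : {linear A -> L} := HB.pack psi (GRing.isLinear.Build F A L _ psi lin).
have psiX := monoid_morphism_exp psi mon a.
have : (psi a)^-1 \in <<1; psi a>>%VS by rewrite memvV memv_adjoin.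
move=> /Fadjoin_polyP[p /polyOverP p1 ->].
have /choice[c cP] : forall i, exists c : F, p`_i = c%:A.
  by move=> i; have /vlineP[c ->] := p1 i; exists c.
exists (\sum_(i < size p) c i *: a ^+ i).
rewrite horner_coef -[LHS]/(ell _) linear_sum; apply: eq_bigr => i _.
by rewrite linearZ /= psiX cP -scalerAl mul1r.
Qed.

Section ValuedExtension.
Context {R : realType} {F : fieldType} (v : group_norm R F).
Hypotheses (vM : is_valuation v) (v_lc : locally_compact [set: normed v])
  (v_nt : ~ trivial_valuation v).
Context {L : fieldExtType F} (vL : group_norm R L).
Hypothesis vLE : extends_valued v vL.

Lemma ext_seminorm : vector_seminorm v vL.
Proof.
have [vLM vLF] := vLE; split; [exact: gnorm_ge0|exact: gnormD|].
by move=> c x; rewrite -[c *: x]mul1r -scalerCA vLM vLF.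
Qed.

Let idL : {linear L -> L} := \1%VF.

Let vL0P x : vL x = 0 <-> idL x = 0.
Proof. by rewrite /= id_lfunE; exact: gnorm_eq0. Qed.

(** Valuations extend uniquely to L: an automorphism is bounded for vL,
    comparing powers brings the bound down to 1, and finite order turns the
    inequality into an equality. *)
Lemma galois_aut_isometry (g : galois_aut L) x : vL (g x) = vL x.
Proof.
have [vLM vLF] := vLE.
have gX := monoid_morphism_exp g (galois_aut_monoid g).
have le y : vL (g y) <= vL y.
  have [||||C C0 CP] := vsn_dominated v vM v_lc v_nt idL vL (vL \o g).
  - exact: ext_seminorm.
  - have [_ sD sZ] := ext_seminorm; split=> /=; first by move=> z; exact: gnorm_ge0.
      by move=> z t; rewrite linearD.
    by move=> c z; rewrite linearZ sZ.
  - exact: vL0P.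
  - by move=> z /=; rewrite id_lfunE => ->; rewrite linear0 gnorm0.
  apply: (le_of_pow_le _ _ C); first exact: gnorm_ge0.
  by move=> n; rewrite -!(valX vL vLM) -gX; exact: CP.
have [n n0 gn] := galois_aut_finite_order g.
apply/le_anti; rewrite le //=.
have -> : vL x = vL (iter n.-1 g (g x)) by rewrite -iterSr prednK // gn.
by elim: n.-1 => //= m; apply: le_trans.
Qed.

Lemma coord_bounded (i : 'I_(\dim {:L})) :
  exists C : R, forall x, v (coord (vbasis {:L}) i x) <= C * vL x.
Proof.
have [||||C C0 CP] := vsn_dominated v vM v_lc v_nt idL vL
  (v \o coord (vbasis {:L}) i).
- exact: ext_seminorm.
- split=> /=; first by move=> z; exact: gnorm_ge0.
    by move=> z t; rewrite linearD gnormD.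
  by move=> c z; rewrite linearZ vM.
- exact: vL0P.
- by move=> z /=; rewrite id_lfunE => ->; rewrite linear0 gnorm0.
by exists C.
Qed.

Lemma coord_continuous (i : 'I_(\dim {:L})) :
  continuous (coord (vbasis {:L}) i : normed vL -> normed v).
Proof.
have [C CP] := coord_bounded i.
by apply: (normed_lipschitz_continuous vL v _ C) => x y; rewrite -linearB; exact: CP.
Qed.

(** The coordinates of a bounded set stay in a compact ball of F, and their
    limits along an ultrafilter are the coordinates of a limit. *)
Lemma ext_ball_compact (r : R) : compact [set x : normed vL | vL x <= r].
Proof.
rewrite compact_ultra => U UU Ur.
pose b := vbasis {:L}.
have xb x : x = \sum_i coord b i x *: b`_i.
  by apply: coord_span; rewrite (span_basis (vbasisP _)) memvf.
have /choice[l lP] : forall i, exists l : normed v,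
    (fun x : normed vL => coord b i x : normed v) @ U --> l.
  move=> i; have [C CP] := coord_bounded i.
  have [|l _] := ultra_compact_cvg U _
     (fun x : normed vL => coord b i x : normed v) UU
     (val_ball_compact v vM v_lc v_nt (`|C| * r)).
    apply: filterS Ur => x /= xr; apply: le_trans (CP x) _.
    apply: le_trans (_ : `|C| * vL x <= _); last by rewrite ler_wpM2l.
    by rewrite ler_wpM2r ?gnorm_ge0 ?ler_norm.
  by exists l.
pose y : L := \sum_i (l i : F) *: b`_i.
have Uy : (id : normed vL -> normed vL) @ U --> (y : normed vL).
  apply/normed_cvgP => e e0; pose M := 1 + \sum_i vL b`_(i : 'I_(\dim {:L})).
  have M0 : 0 < M by rewrite ltr_wpDr // sumr_ge0 // => i _; apply: gnorm_ge0.
  have eM0 : 0 < e / M by rewrite divr_gt0.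
  have : \forall x \near U, forall i, v (coord b i x - (l i : F)) < e / M.
    by apply: filter_forall => i; apply: (normed_cvgP v _ _).1 (lP i) _ eM0.
  apply: filterS => x cx.
  have -> : (x : L) - y = \sum_i (coord b i x - (l i : F)) *: b`_i.
    by rewrite [X in X - _]xb -sumrB; apply: eq_bigr => i _; rewrite scalerBl.
  apply: le_lt_trans (vsn_sum v _ _ _ ext_seminorm) _.
  have -> : e = e / M + \sum_(i < \dim {:L}) (e / M) * vL b`_i.
    by rewrite -mulr_sumr -[X in X + _]mulr1 -mulrDr divfK // gt_eqF.
  apply: ltr_pwDl => //; apply: ler_sum => i _.
  rewrite (vsn_scale _ _ ext_seminorm) ler_wpM2r ?gnorm_ge0 //.
  exact/ltW/cx.
exists (y : normed vL); split; last exact: Uy.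
apply/ler_addgt0Pl => e e0.
have [x [xr xy]] := filter_ex (filterI Ur ((normed_cvgP vL _ _).1 Uy _ e0)).
have := gnorm_lerB vL y x; rewrite gnorm_sym /= in xr xy *; lra.
Qed.

End ValuedExtension.

(** * Multiplicative seminorms attaining the norm of an element *)

Section SquareMultiplicativeSeminorms.
Context {R : realType} {A : comNzRingType} (nA : A -> R).

(** The candidates among which a minimal one will be multiplicative. Field
    sms_sq is one half of p (x ^+ 2) = p x ^+ 2; sms_mul gives the other. *)
Record sm_seminorm (p : A -> R) : Prop := {
  sms_ge0 : forall x, 0 <= p x;
  sms_bounded : forall x, p x <= nA x;
  sms_add : forall x y, p (x + y) <= p x + p y;
  sms_mul : forall x y, p (x * y) <= p x * p y;
  sms_sq : forall x, p x ^+ 2 <= p (x ^+ 2);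
  sms_one : p 1 = 1
}.

(** Exponents that are powers of 2 follow by iterated squaring; any n lies
    below one of them, and submultiplicativity carries the lower bound down. *)
Lemma sms_pow p x n : sm_seminorm p -> p (x ^+ n) = p x ^+ n.
Proof.
move=> ps; have p0 := sms_ge0 _ ps; have pM := sms_mul _ ps.
have le m y : p (y ^+ m) <= p y ^+ m.
  elim: m => [|m IH]; first by rewrite !expr0 (sms_one _ ps).
  by rewrite !exprS (le_trans (pM _ _)) // ler_wpM2l.
have [px0|px0] := eqVneq (p x) 0.
  case: n => [|n]; first by rewrite !expr0 (sms_one _ ps).
  by apply/le_anti; rewrite le /= px0 expr0n p0.
have px : 0 < p x by rewrite lt_def px0 p0.
have two k : p x ^+ (2 ^ k) <= p (x ^+ (2 ^ k)).
  elim: k => [|k IH]; first by rewrite !expr1.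
  rewrite expnSr !exprM; apply: le_trans (sms_sq _ ps _).
  by rewrite ler_pXn2r ?nnegrE ?exprn_ge0.
apply/le_anti; rewrite le /=.
have n2 : (n <= 2 ^ n)%N by rewrite ltnW // ltn_expl.
rewrite -(@ler_pM2r _ (p x ^+ (2 ^ n - n))) ?exprn_gt0 // -exprD subnKC //.
apply: le_trans (two n) _; rewrite -{1}(subnKC n2) exprD.
by apply: le_trans (pM _ _) _; rewrite ler_wpM2l.
Qed.

Section DirectedInfimum.
Context {I : Type} (i0 : I) (f : I -> A -> R).
Hypothesis f_ge0 : forall i x, 0 <= f i x.

Definition pointwise_inf (x : A) : R := inf (range (f ^~ x)).

Lemma pointwise_inf_le i x : pointwise_inf x <= f i x.
Proof.
apply: ge_inf; last by exists i.
by exists 0 => _ [j _ <-].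
Qed.

Lemma le_pointwise_inf c x : (forall i, c <= f i x) -> c <= pointwise_inf x.
Proof.
move=> cf; apply: lb_le_inf; first by exists (f i0 x), i0.
by move=> _ [i _ <-].
Qed.

Hypothesis f_directed : forall i j, exists k, forall x, f k x <= f i x /\ f k x <= f j x.

(** Directedness replaces independent choices of i and j for the two factors
    by a common one. *)
Lemma pointwise_inf_mul (z : R) x y :
  (forall i, z <= f i x * f i y) -> z <= pointwise_inf x * pointwise_inf y.
Proof.
have inf_mulr c (t : R) w : 0 <= t -> (forall i, c <= f i w * t) -> c <= pointwise_inf w * t.
  rewrite le_eqVlt => /orP[/eqP <- /(_ i0)|t0 ct]; first by rewrite !mulr0.
  by rewrite -ler_pdivrMr //; apply: le_pointwise_inf => i; rewrite ler_pdivrMr.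
have inf0 w : 0 <= pointwise_inf w by exact: le_pointwise_inf.
move=> zf; apply: (inf_mulr) => // i; rewrite mulrC; apply: inf_mulr => // j.
have [k kP] := f_directed i j; apply: le_trans (zf k) _.
by rewrite mulrC; apply: ler_pM => //; have [] := kP x; have [] := kP y.
Qed.

Hypotheses (f_bounded : forall i x, f i x <= nA x)
  (f_add : forall i x y, f i (x + y) <= f i x + f i y)
  (f_mul : forall i, exists k, forall x y, f k (x * y) <= f i x * f i y)
  (f_sq : forall i x, f i x ^+ 2 <= f i (x ^+ 2))
  (f_one : forall i, f i 1 = 1).

(** This covers both chains of seminorms and the decreasing sequences that
    define a localization. The terms of the latter need not be
    submultiplicative, whence the second index k in f_mul. *)
Lemma sms_pointwise_inf : sm_seminorm pointwise_inf.
Proof.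
have inf0 x : 0 <= pointwise_inf x by exact: le_pointwise_inf.
split=> //.
- by move=> x; exact: le_trans (pointwise_inf_le i0 x) (f_bounded _ _).
- move=> x y; rewrite -lerBlDr; apply: le_pointwise_inf => i.
  rewrite lerBlDr -lerBlDl; apply: le_pointwise_inf => j.
  have [k kP] := f_directed i j; have [ki _] := kP x; have [_ kj] := kP y.
  rewrite lerBlDl; apply: le_trans (pointwise_inf_le k _) _.
  exact: le_trans (f_add _ _ _) (lerD ki kj).
- move=> x y; apply: pointwise_inf_mul => i; have [k kP] := f_mul i.
  exact: le_trans (pointwise_inf_le k _) (kP _ _).
- move=> x; apply: le_pointwise_inf => i; apply: le_trans (f_sq i x).
  by rewrite ler_pXn2r ?nnegrE // pointwise_inf_le.
- apply/le_anti/andP; split; first by rewrite -(f_one i0) pointwise_inf_le.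
  by apply: le_pointwise_inf => i; rewrite f_one.
Qed.

End DirectedInfimum.

(** The sequence decreases when p is submultiplicative and p b > 0, so the
    infimum is its limit; the limit, unlike p, is scaled by multiplication by b
    by at least p b. *)
Definition localize (p : A -> R) (b : A) : A -> R :=
  pointwise_inf (fun n x => p (b ^+ n * x) / p b ^+ n).

Section Localization.
Variables (p : A -> R) (b : A).
Hypotheses (ps : sm_seminorm p) (pb : 0 < p b).

Let u n x := p (b ^+ n * x) / p b ^+ n.

Let u_ge0 n x : 0 <= u n x.
Proof. by rewrite divr_ge0 ?exprn_ge0 ?(sms_ge0 _ ps). Qed.

Let u_shift n x : u n (b * x) = p b * u n.+1 x.
Proof.
rewrite /u mulrA -exprSr [p b ^+ n.+1]exprS invfM.
by rewrite [RHS]mulrCA mulVKf // gt_eqF.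
Qed.

Let u_dec n m x : (n <= m)%N -> u m x <= u n x.
Proof.
move=> /subnK <-; elim: (m - n)%N => [|k IH] //; apply: le_trans IH.
rewrite addSn /u ler_pdivrMr ?exprn_gt0 // exprS -mulrA [X in _ <= X]mulrC.
rewrite [p b ^+ _.+1]exprS mulrAC -mulrA divfK ?expf_neq0 ?gt_eqF //.
exact: sms_mul.
Qed.

Lemma sms_localize : sm_seminorm (localize p b).
Proof.
have pX := sms_pow _ _ _ ps.
apply: (sms_pointwise_inf 0%N) => //.
- by move=> i j; exists (maxn i j) => x; rewrite !u_dec ?leq_maxl ?leq_maxr.
- move=> i x; apply: le_trans (u_dec 0 i x (leq0n i)) _.
  by rewrite /u !expr0 mul1r divr1; exact: sms_bounded.
- move=> i x y; rewrite -mulrDl ler_wpM2r ?invr_ge0 ?exprn_ge0 ?(sms_ge0 _ ps) //.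
  by rewrite mulrDr; exact: sms_add.
  (* The index doubles because b ^+ (i + i) splits between the two factors. *)
- move=> i; exists (i + i)%N => x y.
  rewrite mulrACA -invfM -exprD ler_wpM2r ?invr_ge0 ?exprn_ge0 ?(sms_ge0 _ ps) //.
  by rewrite exprD mulrACA; exact: sms_mul.
- move=> i x; apply: le_trans (u_dec i (i + i) _ (leq_addr _ _)).
  rewrite /u expr_div_n -exprM muln2 addnn ler_wpM2r ?invr_ge0 ?exprn_ge0 ?(sms_ge0 _ ps) //.
  by rewrite -addnn exprD -!expr2 -exprMn; exact: sms_sq.
- by move=> i; rewrite mulr1 pX divff // expf_neq0 // gt_eqF.
Qed.

Lemma localize_le x : localize p b x <= p x.
Proof.
apply: le_trans (pointwise_inf_le _ u_ge0 0%N x) _.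
by rewrite /u !expr0 mul1r divr1.
Qed.

Lemma localize_mul_ge x : p b * localize p b x <= localize p b (b * x).
Proof.
apply: (le_pointwise_inf 0%N) => n; rewrite -/(u n _) u_shift.
by rewrite ler_wpM2l ?(sms_ge0 _ ps) //; exact: pointwise_inf_le.
Qed.

Lemma localize_preserves a r : 0 <= r -> (forall x, r * p x <= p (a * x)) ->
  forall x, r * localize p b x <= localize p b (a * x).
Proof.
move=> r0 pa x; apply: (le_pointwise_inf 0%N) => n.
apply: le_trans (_ : r * u n x <= _).
  by rewrite ler_wpM2l //; exact: pointwise_inf_le.
rewrite /u /= (mulrA r) ler_wpM2r ?invr_ge0 ?exprn_ge0 ?(sms_ge0 _ ps) //.
by rewrite mulrCA.
Qed.

Lemma localize_le1 x : p b * localize p b x <= p (b * x).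
Proof.
rewrite mulrC -ler_pdivlMr //.
by apply: le_trans (pointwise_inf_le _ u_ge0 1%N x) _; rewrite /u !expr1.
Qed.

End Localization.

(** A minimal seminorm is unchanged by localization at any b with p b > 0,
    hence multiplicative; the inequality r * p x <= p (a * x) survives both
    localization and infima of chains, so it can be imposed beforehand. *)
Lemma sms_minimal_multiplicative (a : A) (r : R) p0 :
  0 <= r -> sm_seminorm p0 -> (forall x, r * p0 x <= p0 (a * x)) ->
  exists p, [/\ sm_seminorm p, forall x y, p (x * y) = p x * p y & r <= p a].
Proof.
move=> r0 p0s p0a.
pose T := {p : A -> R | sm_seminorm p /\ forall x, r * p x <= p (a * x)}.
pose below (p q : T) := `[< forall x, proj1_sig q x <= proj1_sig p x >].
have t0 : T by exists p0.
have [||C totC|[p [ps pa]] pmin] := ZL_preorder (R := below) t0.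
- by move=> p; apply/asboolP.
- move=> q p s /asboolP pq /asboolP qs; apply/asboolP => x.
  exact: le_trans (qs x) (pq x).
- have [[c0 Cc0]|C0] := pselect (exists c, C c); last first.
    by exists t0 => s Cs; case: C0; exists s.
  pose f (c : {c : T | C c}) := proj1_sig (proj1_sig c).
  pose i0 : {c : T | C c} := exist _ c0 Cc0.
  have fs c : sm_seminorm (f c) by case: (proj2_sig (proj1_sig c)).
  have f0 c x : 0 <= f c x by exact: sms_ge0.
  have q : sm_seminorm (pointwise_inf f).
    apply: (sms_pointwise_inf i0) => //.
    + move=> i j; have [ij|ji] := totC _ _ (proj2_sig i) (proj2_sig j).
        by exists j => x; split=> //; move/asboolP: ij; apply.
      by exists i => x; split=> //; move/asboolP: ji; apply.
    + by move=> i x; exact: sms_bounded.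
    + by move=> i x y; exact: sms_add.
    + by move=> i; exists i => x y; exact: sms_mul.
    + by move=> i x; exact: sms_sq.
    + by move=> i; exact: sms_one.
  have qa x : r * pointwise_inf f x <= pointwise_inf f (a * x).
    apply: (le_pointwise_inf i0) => i.
    have [_ /(_ x)] := proj2_sig (proj1_sig i); apply: le_trans.
    by rewrite ler_wpM2l //; exact: (pointwise_inf_le f f0 i).
  exists (exist _ (pointwise_inf f) (conj q qa)) => s Cs; apply/asboolP => x /=.
  exact: (pointwise_inf_le f f0 (exist _ s Cs)).
exists p; split=> // [x y|]; last first.
  by have := pa 1; rewrite mulr1 (sms_one _ ps) mulr1.
apply/le_anti; rewrite (sms_mul _ ps) /=.
have /orP[/eqP <-|px] : (0 == p x) || (0 < p x).
- by rewrite -le_eqVlt (sms_ge0 _ ps).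
- by rewrite mul0r (sms_ge0 _ ps).
have ls := sms_localize p x ps px.
have la := localize_preserves p x ps a r r0 pa.
pose l : T := exist _ (localize p x) (conj ls la).
have /pmin/asboolP/(_ y) /= le_pl : below (exist _ p (conj ps pa)) l.
  by apply/asboolP => z /=; exact: localize_le.
apply: le_trans (localize_le1 p x ps px y).
by rewrite ler_wpM2l ?(sms_ge0 _ ps).
Qed.

(** Localizing nA at a first makes the inequality with r = nA a available for
    the starting seminorm. *)
Lemma exists_norming_multiplicative (a : A) : sm_seminorm nA -> nA a != 0 ->
  exists p, [/\ sm_seminorm p, forall x y, p (x * y) = p x * p y & p a = nA a].
Proof.
move=> nAs na0; have na : 0 < nA a by rewrite lt_def na0 (sms_ge0 _ nAs).
have [|p [ps pM pa]] := sms_minimal_multiplicative a (nA a) (localize nA a) (ltW na)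
  (sms_localize _ _ nAs na).
  exact: localize_mul_ge.
exists p; split=> //; apply/le_anti; rewrite pa andbT.
exact: sms_bounded.
Qed.

End SquareMultiplicativeSeminorms.

(** * Characters as algebra maps *)

Section ResidueClass.
Context {A : comNzRingType} (I : prime_idealr A).

Lemma residue_class_eq a b : (residue_class I a == residue_class I b) = (a - b \in I).
Proof. by rewrite Quotient.idealrBE. Qed.

Lemma residue_class_surj (x : residue I) : exists a, residue_class I a = x.
Proof. by exists (repr (x : {ideal_quot I})); exact: reprK. Qed.

Lemma residue_classB : zmod_morphism (residue_class I).
Proof. by move=> x y; exact: (rmorphB \pi_{ideal_quot I}%qT). Qed.

Lemma residue_class_monoid : monoid_morphism (residue_class I).
Proof.
split; first exact: (rmorph1 \pi_{ideal_quot I}%qT).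
by move=> x y; exact: (rmorphM \pi_{ideal_quot I}%qT).
Qed.

End ResidueClass.

Section QuotientClass.
Context {R : realType} {F : fieldType} {A : comAlgType F} {nA : group_norm R A}.
Variable J : M0 nA.

Lemma quot_class_eqP a b : quot_class J a = quot_class J b <-> (J : set A) (a - b).
Proof.
split=> [/eqP|Jab]; last apply/eqP; rewrite residue_class_eq.
  by rewrite /= /M0_pred inE.
by rewrite /= /M0_pred inE.
Qed.

Lemma quot_class_surj (x : quot J) : exists a, quot_class J a = x.
Proof. exact: residue_class_surj. Qed.

Lemma quot_classB : zmod_morphism (quot_class J).
Proof. exact: residue_classB. Qed.

Lemma quot_class_monoid : monoid_morphism (quot_class J).
Proof. exact: residue_class_monoid. Qed.

End QuotientClass.

Lemma linear_of_constants {F : fieldType} {A : algType F} {L : algType F} (f : A -> L) :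
  zmod_morphism f -> monoid_morphism f -> (forall c : F, f c%:A = c%:A) -> linear f.
Proof.
move=> fB [_ fM] fc c x y.
by rewrite zmod_morphism_add // -mulr_algl fM fc mulr_algl.
Qed.

Section Characters.
Context {R : realType} {F : fieldType} {A : comAlgType F} {nA : group_norm R A}.
Context {L : fieldExtType F}.
Implicit Types x y : character nA L.

Lemma char_eval_zmod x : zmod_morphism (char_eval x).
Proof. by move=> a b; rewrite /char_eval quot_classB (iso_zmod (char_isoP x)). Qed.

Lemma char_eval_monoid x : monoid_morphism (char_eval x).
Proof.
have [c1 cM] := quot_class_monoid (char_ker x).
have [i1 iM] := iso_monoid (char_isoP x).
by split=> [|a b]; rewrite /char_eval ?c1 ?i1 // cM iM.
Qed.

Lemma char_eval_const x (c : F) : char_eval x c%:A = c%:A.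
Proof. exact: iso_fix (char_isoP x) c. Qed.

Lemma char_eval_linear x : linear (char_eval x).
Proof.
exact: (linear_of_constants _ (char_eval_zmod x) (char_eval_monoid x)
  (char_eval_const x)).
Qed.

Lemma char_eval_kernel x a : char_eval x a = 0 <-> (char_ker x : set A) a.
Proof.
have c0 := zmod_morphism_zero _ (char_eval_zmod x).
split=> [ca|xa].
  rewrite -[a]subr0; apply/quot_class_eqP; apply: (iso_inj (char_isoP x)).
  by rewrite -/(char_eval x a) ca -c0.
rewrite -c0; congr char_iso; apply/quot_class_eqP.
by rewrite subr0.
Qed.

(** The values determine the kernel, then the map on the quotient; the other
    components of a character are proofs. *)
Lemma char_eval_inj x y : char_eval x =1 char_eval y -> x = y.
Proof.
move=> xy.
have : char_ker x = char_ker y.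
  have : (char_ker x : set A) = char_ker y.
    by apply/seteqP; split=> a /char_eval_kernel h; apply/char_eval_kernel;
      [rewrite -xy|rewrite xy].
  case: (char_ker x) (char_ker y) => [s1 i1 p1 c1 k1] [s2 i2 p2 c2 k2] /= s12.
  by case: _ / s12 in i2 p2 c2 k2 *; congr MkM0; exact: Prop_irrelevance.
case: x y xy => [Jx fx px] [Jy fy py] + /= Jxy.
case: _ / Jxy in fy py * => xy.
have fxy : fx = fy.
  by apply/funext => q; have [a <-] := quot_class_surj _ q; exact: (xy a).
by case: _ / fxy in py xy *; congr MkCharacter; exact: Prop_irrelevance.
Qed.

Lemma bms_one (N : A -> R) : bounded_mult_seminorm nA N -> N 1 = 1.
Proof.
move=> Ns; have [a Na] := bms_nonzero Ns.
by apply: (mulIf (introN eqP Na)); rewrite -(bms_mul Ns) !mul1r.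
Qed.

(** The kernel is closed because N is 1-Lipschitz for nA. *)
Lemma bms_M0 (N : A -> R) : bounded_mult_seminorm nA N ->
  exists J : M0 nA, (J : set A) = [set a | N a = 0].
Proof.
move=> Ns; pose S := [set a | N a = 0].
have SP a : reflect (N a = 0) (a \in S) by apply: (iffP idP); rewrite inE.
have Sid : idealr_closed (in_set S).
  split; first by apply/SP; exact: bms_zero Ns.
    by apply/negP => /SP; rewrite (bms_one _ Ns) => /eqP; rewrite oner_eq0.
  move=> a u w /SP u0 /SP w0; apply/SP/le_anti; rewrite (bms_ge0 Ns) andbT.
  by apply: le_trans (bms_add Ns _ _) _; rewrite (bms_mul Ns) u0 w0 mulr0 addr0.
have Spr : prime_idealr_closed (in_set S).
  move=> a b /SP; rewrite (bms_mul Ns) => /eqP; rewrite mulf_eq0.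
  by move=> /orP[] /eqP ?; apply/orP; [left|right]; exact/SP.
have Scl : closed (S : set (normed nA)).
  have -> : S = [set a | N a <= 0].
    apply/seteqP; split=> a /=; first by move=> ->.
    by move=> a0; apply/le_anti; rewrite a0 (bms_ge0 Ns).
  apply: (normed_le_closed nA (N : normed nA -> R)) => a b.
  rewrite lerBlDr -{1}(subrK (b : A) a); apply: le_trans (bms_add Ns _ _) _.
  by rewrite lerD2r; exact: bms_bounded Ns _.
by exists (MkM0 Sid Spr Scl (ex_intro2 _ _ N Ns erefl)).
Qed.

(** Constructs characters from maps on A itself; their image is a subfield by
    [alg_map_inv]. *)
Lemma character_of_alg_map (J : M0 nA) (psi : A -> L) :
  linear psi -> monoid_morphism psi -> (forall a, psi a = 0 <-> (J : set A) a) ->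
  exists x : character nA L, char_eval x =1 psi.
Proof.
move=> lin mon ker; have [psi1 psiM] := mon.
pose ell : {linear A -> L} := HB.pack psi (GRing.isLinear.Build F A L _ psi lin).
have psiB a b : psi (a - b) = psi a - psi b by exact: (linearB ell).
have psic (c : F) : psi c%:A = c%:A.
  by rewrite -[LHS]/(ell _) linearZ /= psi1.
have psiE a b : quot_class J a = quot_class J b <-> psi a = psi b.
  rewrite quot_class_eqP -ker psiB.
  by split=> [/eqP|->]; [rewrite subr_eq0 => /eqP|rewrite subrr].
have /choice[r rP] := @quot_class_surj _ _ _ _ J.
pose phi q := psi (r q).
have phiE a : phi (quot_class J a) = psi a by apply/psiE; rewrite rP.
have rng z : (z \in range phi) = (z \in range psi).
  apply/idP/idP; rewrite !inE => -[q _ <-]; first by exists (r q).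
  by exists (quot_class J q).
have phiP : is_iso_onto_subfield (fun c : F => quot_class J c%:A) phi.
  split.
  - by move=> p q; rewrite -(rP p) -(rP q) -quot_classB !phiE.
  - have [q1 qM] := quot_class_monoid J.
    split; first by rewrite -q1 phiE.
    by move=> p q; rewrite -(rP p) -(rP q) -qM !phiE.
  - by move=> p q /psiE; rewrite !rP.
  - by move=> c; rewrite phiE.
  - split=> [|y z|y z].
    + by rewrite rng inE; exists 1.
    + by rewrite !rng !inE => -[a _ <-] [b _ <-]; exists (a - b).
    + rewrite !rng !inE => -[a _ <-] [b _ <-].
      have [b' b'E] := alg_map_inv psi b lin mon.
      by exists (a * b'); rewrite // psiM b'E.
by exists (MkCharacter phiP).
Qed.

(** The embedding of Frac (A / J) into L restricts to A / J. *)
Lemma character_with_kernel (J : M0 nA) : basic_dimension_witness nA L ->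
  exists x : character nA L, forall a, char_eval x a = 0 <-> (J : set A) a.
Proof.
move=> [/(_ J)[phi phiP] _].
pose psi a := phi (FracField.tofrac (quot_class J a)).
have [q1 qM] := quot_class_monoid J.
have [p1 pM] := iso_monoid phiP.
have psiB : zmod_morphism psi.
  by move=> a b; rewrite /psi quot_classB rmorphB (iso_zmod phiP).
have psim : monoid_morphism psi.
  by split=> [|a b]; rewrite /psi ?q1 ?rmorph1 // qM rmorphM pM.
have psil := linear_of_constants _ psiB psim (iso_fix phiP).
have psi0 := zmod_morphism_zero _ psiB.
have ker a : psi a = 0 <-> (J : set A) a.
  rewrite -{1}psi0 -{2}[a]subr0 -quot_class_eqP.
  split=> [/(iso_inj phiP)/eqP|]; first by rewrite tofrac_eq => /eqP.
  by rewrite /psi => ->.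
have [x xE] := character_of_alg_map J psi psil psim ker.
by exists x => a; rewrite xE.
Qed.

End Characters.

(** * Absolute values of characters *)

Section NormsOfCharacters.
Context {R : realType} {F : fieldType} (v : group_norm R F).
Hypotheses (vM : is_valuation v) (v_lc : locally_compact [set: normed v])
  (v_nt : ~ trivial_valuation v).
Context {A : comAlgType F} (nA : group_norm R A).
Hypothesis A_banach : is_unital_banach v nA.
Context {L : fieldExtType F} (vL : group_norm R L).
Hypothesis vLE : extends_valued v vL.

(** A multiplicative seminorm bounded by nA agrees with v on scalars: the bound
    applies to c and to its inverse. *)
Lemma bms_seminorm (N : A -> R) : bounded_mult_seminorm nA N -> vector_seminorm v N.
Proof.
move=> Ns; have N1 := bms_one _ Ns.
have le c : N c%:A <= v c.
  apply: le_trans (bms_bounded Ns _) _.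
  by rewrite (banach_scale A_banach) (banach_one A_banach) mulr1.
split; [exact: bms_ge0 Ns|exact: bms_add Ns|move=> c x].
rewrite -mulr_algl (bms_mul Ns); congr (_ * _).
have [->|c0] := eqVneq c 0; first by rewrite scale0r gnorm0 (bms_zero Ns).
apply/le_anti; rewrite le /=.
have vc := val_gt0 v c c0.
have : 1 <= N c%:A * (v c)^-1.
  have <- : N (c%:A * (c^-1)%:A) = 1.
    by rewrite mulr_algl scalerA mulfV // scale1r.
  by rewrite -(valV v vM) (bms_mul Ns) ler_wpM2l ?(bms_ge0 Ns).
by rewrite ler_pdivlMr // mul1r.
Qed.

(** The absolute value is determined by the kernel: on the image of x, a
    finite-dimensional space, the norms vL and N are comparable, and powers
    improve the comparison to vL <= N; inverses turn it into an equality. *)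
Lemma char_eval_norm (N : A -> R) (x : character nA L) :
  bounded_mult_seminorm nA N -> (forall a, N a = 0 <-> char_eval x a = 0) ->
  forall a, vL (char_eval x a) = N a.
Proof.
move=> Ns ker; have [vLM vLF] := vLE.
have [x1 xM] := char_eval_monoid x.
have xlin := char_eval_linear x.
have xX := monoid_morphism_exp _ (char_eval_monoid x).
have Nm : monoid_morphism N by split; [exact: (bms_one N Ns)|exact: bms_mul Ns].
have NX := monoid_morphism_exp N Nm.
have [ell ellE] : exists ell : {linear A -> L}, ell =1 char_eval x.
  pose l : {linear A -> L} :=
    HB.pack (char_eval x) (GRing.isLinear.Build F A L _ (char_eval x) xlin).
  by exists l.
have le a : vL (char_eval x a) <= N a.
  have [||||C C0 CP] := vsn_dominated v vM v_lc v_nt ell N (vL \o ell).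
  - exact: bms_seminorm.
  - have [_ sD sZ] := ext_seminorm v vL vLE; split=> /=; first by move=> z; exact: gnorm_ge0.
      by move=> z t; rewrite linearD.
    by move=> c z; rewrite linearZ sZ.
  - by move=> z; rewrite ellE; exact: ker.
  - by move=> z /= ->; rewrite gnorm0.
  apply: (le_of_pow_le _ _ C); first exact: bms_ge0 Ns _.
  move=> n; rewrite -(valX vL vLM) -xX -NX -ellE; exact: CP.
move=> a; apply/le_anti; rewrite le /=.
have [xa0|xa] := eqVneq (char_eval x a) 0.
  by rewrite ((ker a).2 xa0) gnorm_ge0.
have [b xb] := alg_map_inv (char_eval x) a xlin (char_eval_monoid x).
have va := val_gt0 vL _ xa.
have ab1 : N a * N b = 1.
  have xab : char_eval x (a * b - 1) = 0.
    by rewrite char_eval_zmod xM x1 xb mulfV // subrr.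
  have Nab := (ker _).2 xab.
  have Nabn : N (1 - a * b) = 0 by rewrite -opprB (vsnN v vM _ _ (bms_seminorm _ Ns)).
  rewrite -(bms_mul Ns) -(bms_one _ Ns); apply/le_anti/andP; split.
    by have := bms_add Ns (a * b - 1) 1; rewrite subrK Nab add0r.
  by have := bms_add Ns (1 - a * b) (a * b); rewrite subrK Nabn add0r.
have := le b; rewrite xb (valV vL vLM) => leb.
have := ler_wpM2l (bms_ge0 Ns a) leb.
by rewrite ab1 ler_pdivrMr // mul1r.
Qed.

Lemma char_eval_bounded (x : character nA L) a : vL (char_eval x a) <= nA a.
Proof.
have [N Ns NE] := M0_kernel (char_ker x).
rewrite (char_eval_norm N x Ns); first exact: bms_bounded Ns a.
by move=> b; rewrite char_eval_kernel NE.
Qed.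

Hypothesis nA_square : forall a : A, nA (a ^+ 2) = nA a ^+ 2.
Hypothesis LW : basic_dimension_witness nA L.

(** A multiplicative seminorm taking the value nA a at a has its kernel in
    M0, the character with this kernel exists by finite basic dimension, and
    its absolute value is the seminorm by [char_eval_norm]. *)
Lemma norming_character a : a != 0 ->
  exists x : character nA L, vL (char_eval x a) = nA a.
Proof.
move=> a0.
have nAs : sm_seminorm nA nA.
  split=> //; [exact: gnorm_ge0|exact: gnormD|exact: banach_mul A_banach| |].
  - by move=> b; rewrite nA_square.
  - exact: banach_one A_banach.
have na0 : nA a != 0 by apply: contra a0 => /eqP/gnorm_eq0 ->.
have [N [Ns NM Na]] := exists_norming_multiplicative nA a nAs na0.
have Nb : bounded_mult_seminorm nA N.
  split; [exact: sms_ge0 Ns| |exact: sms_bounded Ns|exact: NM|exact: sms_add Ns|].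
  - by exists 1; rewrite (sms_one _ _ Ns); apply/eqP; rewrite oner_eq0.
  - apply/le_anti; rewrite (sms_ge0 _ _ Ns) andbT.
    by rewrite (le_trans (sms_bounded _ _ Ns 0)) // gnorm0.
have [J JE] := bms_M0 N Nb.
have [x xker] := character_with_kernel J LW.
exists x; rewrite (char_eval_norm N x Nb) // => b.
by rewrite xker JE.
Qed.

End NormsOfCharacters.

(** * The Gelfand topology *)

Section GelfandTopology.
Context {R : realType} {F : fieldType} {A : comAlgType F} {nA : group_norm R A}.
Context {L : fieldExtType F} {vL : group_norm R L}.

Lemma gelfand_continuous (a : A) :
  continuous (gelfand_transform a : character_space nA vL -> normed vL).
Proof.
move=> x.
pose Tc a := Topological.on
  (initial_topology (gelfand_transform a : character nA L -> normed vL)).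
have h : nbhs x `=>` nbhs x by [].
have := (cvg_sup Tc x (nbhs_filter x)).1 h a.
move=> ha D nD; apply: ha.
exact: (initial_continuous (f := gelfand_transform a : character nA L -> normed vL) nD).
Qed.

Lemma character_space_cvg (U : set_system (character_space nA vL))
    (x : character_space nA vL) : Filter U ->
  (forall a, (gelfand_transform a : _ -> normed vL) @ U -->
             (gelfand_transform a x : normed vL)) ->
  U --> x.
Proof.
move=> FU h; apply/cvg_sup => a B [_ [[D oD <-] Dx] DB].
apply: filterS DB _; apply: (h a).
exact: open_nbhs_nbhs.
Qed.

End GelfandTopology.

(** * Periods, clopen sets and suprema *)

Lemma period_has_order {T : Type} (f : T -> T) n : (0 < n)%N -> iter n f =1 id ->
  exists2 m, has_order f m & (m %| n)%N.
Proof.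
move=> n0 fn; pose P k := (0 < k)%N && `[< iter k f =1 id >].
have exP : exists k, P k by exists n; rewrite /P n0; apply/asboolP.
case: (ex_minnP exP) => m /andP[m0 /asboolP fm] mmin; exists m.
  split=> // k /andP[k0 km] fk.
  by have := mmin k; rewrite /P k0 /= leqNgt km; move=> /(_ (asboolT fk)).
have fmq q x : iter (q * m) f x = x.
  by elim: q => [|q IH] //; rewrite mulSn iterD IH fm.
have fr : iter (n %% m) f =1 id.
  by move=> x; rewrite -{2}(fn x) {2}(divn_eq n m) addnC iterD fmq.
rewrite /dvdn; case: posnP => // r0.
have := mmin (n %% m)%N; rewrite /P r0 leqNgt ltn_pmod //=.
by move=> /(_ (asboolT fr)).
Qed.

Lemma zero_dimensional_hausdorff {X : topologicalType} :
  zero_dimensional X -> hausdorff_space X.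
Proof.
move=> zd x y xy; apply/eqP; apply: contraT => /zd[U [[oU cU] Ux nUy]].
have [z [Uz nUz]] : U `&` ~` U !=set0.
  apply: xy; first exact: open_nbhs_nbhs.
  by apply: open_nbhs_nbhs; split=> //; exact: closed_openC.
by [].
Qed.

Lemma ultrametric_ball_clopen {R : realType} {F : fieldType} (v : group_norm R F)
    (c : F) (r : R) :
  nonarchimedean v -> 0 < r -> clopen [set x : normed v | v ((x : F) - c) < r].
Proof.
move=> ultra r0; split.
  have -> : [set x : normed v | v ((x : F) - c) < r] =
      ~` [set x : normed v | - v ((x : F) - c) <= - r].
    by apply/seteqP; split=> x /=; rewrite lerN2 ltNge => /negP h; exact: h.
  apply: closed_openC.
  apply: (normed_le_closed v (fun x : normed v => - v ((x : F) - c))) => x y.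
  rewrite opprK addrC (gnorm_sym v x y).
  have -> : (y : F) - x = (y - c) - (x - c) by rewrite opprB addrA subrK.
  exact: gnorm_lerB.
move=> x clx /=.
have [y [/= yc]] := clx _ (nbhsx_ballx x r r0).
rewrite normed_ballE /= => xy.
have -> : (x : F) - c = (x - y) - (c - y) by rewrite opprB addrA subrK.
apply: le_lt_trans (ultra _ _) _.
by rewrite gt_max xy gnorm_sym yc.
Qed.

Lemma sup_norm_attained {R : realType} {F : fieldType} {L : fieldExtType F}
    (vL : group_norm R L) {X : topologicalType} (f : X -> L) x :
  (forall y, vL (f y) <= vL (f x)) -> sup_norm vL f = vL (f x).
Proof.
move=> fx; apply/le_anti/andP; split.
  by apply: ge_sup => [|_ [y _ <-]]; [exists (vL (f x)), x|exact: fx].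
by apply: ub_le_sup; [exists (vL (f x)) => _ [y _ <-]; exact: fx|exists x].
Qed.

(** * The character space and the Gelfand representation *)

Section CharacterSpaceTopology.
Context {R : realType} {F : fieldType} (v : group_norm R F).
Hypotheses (vM : is_valuation v) (v_lc : locally_compact [set: normed v])
  (v_nt : ~ trivial_valuation v) (v_ultra : nonarchimedean v).
Context {A : comAlgType F} (nA : group_norm R A).
Hypothesis A_banach : is_unital_banach v nA.
Context {L : fieldExtType F} (vL : group_norm R L).
Hypothesis vLE : extends_valued v vL.
Local Notation X := (character_space nA vL).

(** Values of an ultrafilter of characters at a given a stay in a compact
    ball, so they converge; the limits form again a character. *)
Lemma character_space_compact : compact [set: X].
Proof.
have [vLM vLF] := vLE.
rewrite compact_ultra => U UU _.
have bnd (x : X) a : vL (char_eval x a) <= nA a.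
  exact: (char_eval_bounded v vM v_lc v_nt nA A_banach vL vLE).
have /choice[psi psiP] : forall a : A, exists l : L, vL l <= nA a /\
    (gelfand_transform a : X -> normed vL) @ U --> (l : normed vL).
  move=> a; have [|l lb lU] := ultra_compact_cvg U _
      (gelfand_transform a : X -> normed vL) UU
      (ext_ball_compact v vM v_lc v_nt vL vLE (nA a)).
    by apply: filterE => x; exact: bnd.
  by exists l.
have near a e : 0 < e -> \forall x \near U, vL (char_eval x a - psi a) < e.
  by move=> e0; apply: (normed_cvgP vL _ _).1 (psiP a).2 _ e0.
have zero (y : L) C : (forall e, 0 < e -> vL y <= e * C) -> y = 0.
  move=> yC; apply/(gnorm_eq0 vL)/le_anti; rewrite gnorm_ge0 andbT.
  apply/ler_addgt0Pl => e e0; rewrite addr0.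
  have C1 : 0 < `|C| + 1 by rewrite ltr_wpDl.
  apply: le_trans (yC _ (divr_gt0 e0 C1)) _.
  rewrite mulrAC ler_pdivrMr // ler_wpM2l ?(ltW e0) //.
  by rewrite (le_trans (ler_norm C)) // lerDl.
have psic (c : F) : psi c%:A = c%:A.
  apply/eqP; rewrite -subr_eq0; apply/eqP/(zero _ 1) => e e0; rewrite mulr1.
  have [x] := filter_ex (near c%:A _ e0).
  by rewrite char_eval_const gnorm_sym => /ltW.
have psiB : zmod_morphism psi.
  move=> a b; apply/eqP; rewrite -subr_eq0; apply/eqP/(zero _ 3) => e e0.
  have [x [xab [xa xb]]] := filter_ex (filterI (near (a - b) _ e0)
    (filterI (near a _ e0) (near b _ e0))).
  rewrite char_eval_zmod in xab.
  have -> : psi (a - b) - (psi a - psi b) = (char_eval x a - psi a)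
     - ((char_eval x b - psi b) + (char_eval x a - char_eval x b - psi (a - b))).
    by ring.
  apply: le_trans (gnormD _ _ _) _; rewrite gnormN.
  have := gnormD vL (char_eval x b - psi b) (char_eval x a - char_eval x b - psi (a - b)).
  lra.
have psi1 : psi 1 = 1 by have := psic 1; rewrite !scale1r.
have psiM : {morph psi : a b / a * b}.
  move=> a b; apply/eqP; rewrite -subr_eq0; apply/eqP/(zero _ (nA a + vL (psi b) + 1)).
  move=> e e0.
  have [x [xab [xa xb]]] := filter_ex (filterI (near (a * b) _ e0)
    (filterI (near a _ e0) (near b _ e0))).
  have [_ xM] := char_eval_monoid x; rewrite xM in xab.
  have -> : psi (a * b) - psi a * psi b = char_eval x a * (char_eval x b - psi b)
     + ((char_eval x a - psi a) * psi b - (char_eval x a * char_eval x b - psi (a * b))).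
    by ring.
  apply: le_trans (gnormD _ _ _) _.
  apply: le_trans (lerD (lexx _) (gnormD _ _ _)) _.
  rewrite gnormN !vLM addrA !mulrDr mulr1; apply: lerD (ltW xab).
  apply: lerD; last by rewrite ler_wpM2r ?gnorm_ge0 // ltW.
  by rewrite mulrC; apply: ler_pM; rewrite ?gnorm_ge0 ?(ltW xb).
have psim : monoid_morphism psi by split.
have Nb : bounded_mult_seminorm nA (vL \o psi).
  split=> /=.
  - by move=> a; exact: gnorm_ge0.
  - by exists 1; rewrite psi1 val1 //; apply/eqP; rewrite oner_eq0.
  - by move=> a; have [] := psiP a.
  - by move=> a b; rewrite psiM vLM.
  - by move=> a b; rewrite (zmod_morphism_add psi psiB) gnormD.
  - by rewrite (zmod_morphism_zero psi psiB) gnorm0.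
have [J JE] := bms_M0 _ Nb.
have ker a : psi a = 0 <-> (J : set A) a.
  by rewrite JE /=; exact: iff_sym (gnorm_eq0 vL _).
have [x xE] := character_of_alg_map J psi
  (linear_of_constants _ psiB psim psic) psim ker.
exists (x : X); split=> //; apply: character_space_cvg => a.
by rewrite /gelfand_transform xE; exact: (psiP a).2.
Qed.

(** Two characters differ in some coordinate of some value; the coordinate
    lies in F, where balls are clopen. *)
Lemma character_space_zero_dimensional : zero_dimensional X.
Proof.
move=> x y xy.
have [a axy] : exists a, char_eval x a <> char_eval y a.
  apply: contrapT => /forallNP h; move/eqP: xy; apply.
  by apply: char_eval_inj => a; exact: contrapT (h a).
pose b := vbasis {:L}.
have [i ixy] : exists i, coord b i (char_eval x a) <> coord b i (char_eval y a).
  apply: contrapT => /forallNP h; apply: axy.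
  have inb z : z \in <<b>>%VS by rewrite (span_basis (vbasisP _)) memvf.
  rewrite (coord_span (inb (char_eval x a))) (coord_span (inb (char_eval y a))).
  by apply: eq_bigr => i _; rewrite (contrapT (h i)).
pose f : X -> normed v := fun z => coord b i (gelfand_transform a z).
have fc : continuous f.
  move=> z; exact: (continuous_comp (gelfand_continuous a z)
    (coord_continuous v vM v_lc v_nt vL vLE i _)).
have r0 : 0 < v ((f y : F) - f x).
  by apply: val_gt0; rewrite subr_eq0; apply/eqP => e; exact: ixy.
exists (f @^-1` [set t : normed v | v ((t : F) - f x) < v ((f y : F) - f x)]); split.
- by apply: preimage_clopen => //; exact: ultrametric_ball_clopen.
- by rewrite /= subrr gnorm0.
- by rewrite /= ltxx.
Qed.

Lemma gal_act_continuous (g : galois_aut L) : continuous (gal_act nA vL g).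
Proof.
move=> x; apply: (character_space_cvg (gal_act nA vL g @ nbhs x) _
  (fmap_filter _ (nbhs_filter x))) => a.
have gc : continuous (g : normed vL -> normed vL).
  apply: (normed_lipschitz_continuous vL vL g 1) => y z.
  by rewrite -linearB (galois_aut_isometry v vM v_lc v_nt vL vLE) mul1r.
exact: (continuous_comp (gelfand_continuous a x) (gc _)).
Qed.

Lemma gal_act_iter (g : galois_aut L) n (x : X) a :
  char_eval (iter n (gal_act nA vL g) x) a = iter n g (char_eval x a).
Proof. by elim: n => //= n <-. Qed.

(** The period of g is one of gal_act g, so the order of the latter divides
    that of g. *)
Lemma gal_act_admissible (g : galois_aut L) : admissible_triple (gal_act nA vL g) g.
Proof.
have zd := character_space_zero_dimensional.
split.
- exact: character_space_compact.
- exact: zero_dimensional_hausdorff.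
- exact: zero_dimension_totally_disconnected.
- exact: gal_act_continuous.
have [k k0 gk] := galois_aut_finite_order g.
have [n gn _] := period_has_order g k k0 gk.
have [n0 gnid _] := gn.
have [|m tm mn] := period_has_order (gal_act nA vL g) n n0.
  by move=> x; apply: char_eval_inj => a; rewrite gal_act_iter gnid.
by exists m, n.
Qed.

Hypothesis nA_square : forall a : A, nA (a ^+ 2) = nA a ^+ 2.
Hypothesis LW : basic_dimension_witness nA L.
Local Notation gelfand a := (gelfand_transform a : X -> L).

Lemma gelfand_isometry a : sup_norm vL (gelfand a) = nA a.
Proof.
have [x xa] : exists x : X, vL (char_eval x a) = nA a.
  have norming := norming_character v vM v_lc v_nt nA A_banach vL vLE nA_square LW.
  have [->|/norming//] := eqVneq a 0.
  have [x _] := norming 1 (oner_neq0 A); exists x.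
  by rewrite (zmod_morphism_zero _ (char_eval_zmod x)) !gnorm0.
rewrite -xa; apply: sup_norm_attained => y; rewrite [X in _ <= X]xa.
exact: (char_eval_bounded v vM v_lc v_nt nA A_banach vL vLE).
Qed.

(** Completeness of A, transported by the isometry. *)
Lemma gelfand_sup_complete : sup_complete vL (range (fun a => gelfand a)).
Proof.
move=> u uS uC; have /choice[b bP] : forall n, exists a, gelfand a = u n.
  by move=> n; have [a _ <-] := uS n; exists a.
have uB m (c : A) : (fun x => u m x - gelfand c x) = gelfand (b m - c).
  by apply/funext => x; rewrite -bP /gelfand_transform char_eval_zmod.
pose bn : nat -> normed nA := b.
have cb : cauchy (bn @ \oo).
  apply: cauchy_exP => e e0; have [N NP] := uC _ e0.
  exists (bn N); exists N => // n /= Nn.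
  have := NP N n (leqnn N) Nn; rewrite normed_ballE /= -(bP n).
  by rewrite uB gelfand_isometry.
have lP : bn @ \oo --> lim (bn @ \oo).
  exact: (banach_complete A_banach _ cb).
set l := lim _ in lP.
exists (gelfand (l : A)); first by exists l.
apply/cvgr0Pnorm_lt => e e0.
have [N _ NP] := (normed_cvgP nA (U := \oo) bn l).1 lP _ e0.
exists N => // n /NP /=.
by rewrite uB gelfand_isometry ger0_norm ?gnorm_ge0.
Qed.

Lemma gelfand_function_algebra (g : galois_aut L) : fixedSpace g = 1%VS ->
  function_algebra_over vL (gal_act nA vL g) g (range (fun a => gelfand a)).
Proof.
move=> gF; split=> //.
have scaleE c : c \in fixedSpace g -> exists k : F, c = k%:A.
  by rewrite gF => /vlineP[k ->]; exists k.
split.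
- exact: gal_act_admissible.
- by move=> _ [a _ <-]; split=> //; exact: gelfand_continuous.
- move=> _ _ [a _ <-] [b _ <-]; exists (a + b) => //; apply/funext => x.
  exact: zmod_morphism_add (char_eval_zmod x) a b.
- move=> _ _ [a _ <-] [b _ <-]; exists (a * b) => //; apply/funext => x.
  by have [_ xM] := char_eval_monoid x; exact: xM.
- move=> c _ /scaleE[k ->] [a _ <-]; exists (k%:A * a) => //; apply/funext => x.
  have [_ xM] := char_eval_monoid x.
  by rewrite /gelfand_transform xM char_eval_const.
- move=> c /scaleE[k ->]; exists k%:A => //; apply/funext => x.
  exact: char_eval_const.
- exact: gelfand_sup_complete.
- move=> x y xy; apply: contrapT => nsep; apply: xy; apply: char_eval_inj => a.
  apply: contrapT => nxy; apply: nsep.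
  by exists (gelfand a); first by exists a.
Qed.

Lemma gelfand_isometric_iso :
  isometric_iso_onto vL nA (range (fun a => gelfand a)) (fun a => gelfand a).
Proof.
have x0 (x : X) : char_eval x 0 = 0 := zmod_morphism_zero _ (char_eval_zmod x).
split; [split=> //|split].
- by move=> a b x; exact: zmod_morphism_add (char_eval_zmod x) a b.
- by move=> a b x; have [_ xM] := char_eval_monoid x; exact: xM.
- by move=> c a x; have := char_eval_linear x c a 0; rewrite x0 !addr0.
- by move=> x; have [x1 _] := char_eval_monoid x.
- move=> a b ab; apply/eqP; rewrite -subr_eq0; apply/eqP/(gnorm_eq0 nA).
  rewrite -gelfand_isometry.
  have -> : gelfand (a - b) = gelfand 0.
    apply/funext => x; rewrite /gelfand_transform char_eval_zmod x0.
    by have := congr1 (fun f => f x) ab; rewrite /gelfand_transform => ->; rewrite subrr.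
  by rewrite gelfand_isometry gnorm0.
- exact: gelfand_isometry.
Qed.

End CharacterSpaceTopology.

(** * The representation theorem *)

Theorem theorem6p2p9 (R : realType) (F : fieldType) (vF : group_norm R F)
  (vF_valuation : is_valuation vF)
  (vF_locally_compact : locally_compact [set: normed vF])
  (vF_complete : complete_space (normed vF))
  (vF_nonarchimedean : nonarchimedean vF)
  (vF_nontrivial : ~ trivial_valuation vF)
  (A : comAlgType F) (nA : group_norm R A)
  (A_banach : is_unital_banach vF nA)
  (nA_square : forall a : A, nA (a ^+ 2) = nA a ^+ 2)
  (A_dim : finite_basic_dimension vF nA) :
  exists (L : fieldExtType F) (vL : group_norm R L),
    [/\ extends_valued vF vL,
        basic_dimension_witness nA L /\
        (forall x : character_space nA vL,
          [/\ exists a, char_eval x a <> 0,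
              {morph char_eval x : a b / a * b} &
              linear (char_eval x)]),
        [/\ totally_disconnected [set: character_space nA vL],
            compact [set: character_space nA vL] &
            hausdorff_space (character_space nA vL)] &
        exists (g : galois_aut L) (S : set (character_space nA vL -> L))
               (T : A -> character_space nA vL -> L),
          function_algebra_over vL (gal_act nA vL g) g S /\
          isometric_iso_onto vL nA S T].
Proof.
have [L [vL [vLE LW]]] := A_dim; have [_ [g gF]] := LW.
exists L, vL; split=> //.
- split=> // x; have [x1 xM] := char_eval_monoid x.
  split=> //; last exact: char_eval_linear.
  by exists 1; rewrite x1; apply/eqP; rewrite oner_eq0.
- have [] := gal_act_admissible vF vF_valuation vF_locally_compact vF_nontrivial
    vF_nonarchimedean nA A_banach vL vLE g.
  by split.
- exists g, (range (fun a => gelfand_transform a : character_space nA vL -> L)),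
    (fun a => gelfand_transform a); split.
    exact: (gelfand_function_algebra vF vF_valuation vF_locally_compact vF_nontrivial
      vF_nonarchimedean nA A_banach vL vLE nA_square LW).
  exact: (gelfand_isometric_iso vF vF_valuation vF_locally_compact vF_nontrivial
    nA A_banach vL vLE nA_square LW).
Qed.
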